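(* The system $\mathbf{NQGL}$ does not have the Craig interpolation property.
   Context: Language $\mathcal{L}$: countably many individual variables, Boolean constants $\top,\bot$, connectives $\neg,\to$, quantifier $\forall$, modal operator $\Box$, countably many predicate symbols of each arity (no function symbols, constants or equality). Formulas: $\top$, $\bot$, $P(u_1,\ldots,u_n)$, closed under $\neg$, $\to$, $\forall u$, $\Box$. $\Box^{k}A$ denotes $A$ prefixed by $k$ boxes. $\mathbf{QK}$: all instances of the axioms of classical first-order predicate logic, the axiom $\Box(A\to B)\to(\Box A\to\Box B)$, the rules of predicate logic (modus ponens, generalization) and necessitation $A/\Box A$. $\mathbf{QK4}$ is $\mathbf{QK}$ plus the axiom $\Box A\to\Box\Box A$. $\mathbf{NQGL}$ is obtained from $\mathbf{QK4}$ by adding the infinitary rule: if $\vdash\Box^{n+1}\bot\to A$ for all natural numbers $n$, then $\vdash A$. A logic $\mathbf{L}$ has the Craig interpolation property if for all $\mathcal{L}$-sentences $A,B$ with $\mathbf{L}\vdash A\to B$ there is an $\mathcal{L}$-sentence $C$ containing only predicate symbols occurring in both $A$ and $B$ with $\mathbf{L}\vdash A\to C$ and $\mathbf{L}\vdash C\to B$. *)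

(* Defs.v *)
From mathcomp Require Import all_boot.

Set Implicit Arguments.
Unset Strict Implicit.
Unset Printing Implicit Defensive.

Definition var := nat.

(* A predicate symbol is a pair (n, k): the k-th symbol of arity n. *)
Inductive form : Type :=
| Top
| Bot
| Atom (n k : nat) (us : n.-tuple var)
| Neg (A : form)
| Imp (A B : form)
| All (u : var) (A : form)
| Box (A : form).

Definition boxn (k : nat) (A : form) : form := iter k Box A.

Fixpoint free (x : var) (A : form) : bool :=
  match A with
  | Top | Bot => false
  | Atom _ _ us => x \in us
  | Neg B => free x B
  | Imp B C => free x B || free x C
  | All u B => (x != u) && free x B
  | Box B => free x B
  end.

Definition sentence (A : form) : Prop := forall x, ~~ free x A.

(* Replaces the free occurrences of u by v, without renaming bound variables;
   only meaningful when free_for v u A holds. *)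
Fixpoint subst (u v : var) (A : form) : form :=
  match A with
  | Top => Top
  | Bot => Bot
  | Atom n k us => Atom k (map_tuple (fun w => if w == u then v else w) us)
  | Neg B => Neg (subst u v B)
  | Imp B C => Imp (subst u v B) (subst u v C)
  | All w B => if w == u then All w B else All w (subst u v B)
  | Box B => Box (subst u v B)
  end.

(* No free occurrence of u in A lies in the scope of a quantifier on v. *)
Fixpoint free_for (v u : var) (A : form) : bool :=
  match A with
  | Top | Bot | Atom _ _ _ => true
  | Neg B => free_for v u B
  | Imp B C => free_for v u B && free_for v u C
  | All w B => ~~ free u (All w B) || ((w != v) && free_for v u B)
  | Box B => free_for v u B
  end.

Fixpoint occurs (n k : nat) (A : form) : bool :=
  match A with
  | Top | Bot => false
  | Atom m j _ => (m == n) && (j == k)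
  | Neg B => occurs n k B
  | Imp B C => occurs n k B || occurs n k C
  | All _ B => occurs n k B
  | Box B => occurs n k B
  end.

(* Axioms of classical first-order logic, instantiated with modal formulas. *)
Inductive fol_axiom : form -> Prop :=
| ax_top : fol_axiom Top
| ax_bot A : fol_axiom (Imp Bot A)
| ax_k A B : fol_axiom (Imp A (Imp B A))
| ax_s A B C :
    fol_axiom (Imp (Imp A (Imp B C)) (Imp (Imp A B) (Imp A C)))
| ax_contra A B : fol_axiom (Imp (Imp (Neg A) (Neg B)) (Imp B A))
| ax_inst u v A : free_for v u A -> fol_axiom (Imp (All u A) (subst u v A))
| ax_dist u A B :
    ~~ free u A -> fol_axiom (Imp (All u (Imp A B)) (Imp A (All u B))).

Inductive QK_axiom : form -> Prop :=
| QK_fol A : fol_axiom A -> QK_axiom A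
| QK_K A B : QK_axiom (Imp (Box (Imp A B)) (Imp (Box A) (Box B))).

Inductive QK4_axiom : form -> Prop :=
| QK4_QK A : QK_axiom A -> QK4_axiom A
| QK4_4 A : QK4_axiom (Imp (Box A) (Box (Box A))).

Inductive NQGL : form -> Prop :=
| NQGL_ax A : QK4_axiom A -> NQGL A
| NQGL_mp A B : NQGL (Imp A B) -> NQGL A -> NQGL B
| NQGL_gen u A : NQGL A -> NQGL (All u A)
| NQGL_nec A : NQGL A -> NQGL (Box A)
| NQGL_inf A : (forall n, NQGL (Imp (boxn n.+1 Bot) A)) -> NQGL A.

Definition craig_interpolation (L : form -> Prop) : Prop :=
  forall A B : form, sentence A -> sentence B -> L (Imp A B) ->
  exists C : form,
    [/\ sentence C,
        forall n k, occurs n k C -> occurs n k A && occurs n k B,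
        L (Imp A C)
      & L (Imp C B)].

(* Main.v *)
(* On the chain of natural numbers ordered by [>], the world [w] has rank [w],
   and the truth of a formula without predicate symbols depends only on the
   rank and is eventually constant.  It thus suffices to find sentences [A] and
   [B] with disjoint vocabularies such that [A -> B] is provable, [A] holds at
   worlds of arbitrarily large odd rank and [B] fails at worlds of arbitrarily
   large even rank.  Parity of the rank is expressed with individuals: a
   predicate [L] such that every [x] satisfies [L x <-> Box^b Bot] or has some
   [y] with [L x <-> Box Box (L y)] (both boxed) makes [L x] equivalent to
   [Box^(2i+b) Bot] whenever [x] has a finite index [i]; at a world of finite
   rank any [x] with [~ Box (L x)] has one, and [Box Box (L x)] together with
   [~ Box (L x)] then says that the rank is exactly [2i+b+1]. *)
Require Import Defs.
From mathcomp Require Import all_boot.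

Set Implicit Arguments.
Unset Strict Implicit.
Unset Printing Implicit Defensive.

(** * Natural deduction in NQGL *)

(* The head of [G] is the innermost antecedent, so that [entails (A :: G) B] and
   [entails G (Imp A B)] are convertible. *)
Definition entails (G : seq form) (A : form) : Prop :=
  NQGL (foldl (fun B H => Imp H B) A G).

Lemma NQGL_fol A : fol_axiom A -> NQGL A.
Proof. by move=> axA; apply/NQGL_ax/QK4_QK/QK_fol. Qed.

Lemma entails_thm G A : NQGL A -> entails G A.
Proof.
elim: G A => [|H G IHG] A //= thmA; apply: IHG.
exact: NQGL_mp (NQGL_fol (ax_k A H)) thmA.
Qed.

Lemma entails_mp A G B : entails G (Imp A B) -> entails G A -> entails G B.
Proof.
elim: G A B => [|H G IHG] A B; first exact: NQGL_mp.
move=> GAB GA; apply: (IHG (Imp H A)) GA; apply: (IHG (Imp H (Imp A B))) GAB.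
exact/entails_thm/NQGL_fol/ax_s.
Qed.

Lemma entails_weak H G A : entails G A -> entails (H :: G) A.
Proof.
by apply: (@entails_mp A G (Imp H A)); apply/entails_thm/NQGL_fol/ax_k.
Qed.

Lemma entails_id A G : entails (A :: G) A.
Proof.
apply: (@entails_mp (Imp A (Imp A A)) G (Imp A A));
  last exact/entails_thm/NQGL_fol/ax_k.
apply: (@entails_mp (Imp A (Imp (Imp A A) A)));
  last exact/entails_thm/NQGL_fol/ax_k.
exact/entails_thm/NQGL_fol/ax_s.
Qed.

Lemma entails_id1 A B G : entails [:: A, B & G] B.
Proof. exact/entails_weak/entails_id. Qed.

Lemma entails_absurd G A B : entails G (Neg A) -> entails G A -> entails G B.
Proof.
move=> GnA GA; apply: (entails_mp _ GA).
apply: (@entails_mp (Imp (Neg B) (Neg A))).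
  exact/entails_thm/NQGL_fol/ax_contra.
by apply: entails_mp GnA; apply/entails_thm/NQGL_fol/ax_k.
Qed.

(** Ex falso turns [Bot] into [Neg Top], and contraposing [Imp (Neg A) (Neg Top)] gives
    [Imp Top A]. *)
Lemma entails_contra G A : entails (Neg A :: G) Bot -> entails G A.
Proof.
move=> GnA; apply: (@entails_mp Top); last exact/entails_thm/NQGL_fol/ax_top.
apply: (@entails_mp (Imp (Neg A) (Neg Top))).
  exact/entails_thm/NQGL_fol/ax_contra.
apply: (@entails_mp Bot (Neg A :: G) (Neg Top)) GnA.
exact/entails_thm/NQGL_fol/ax_bot.
Qed.

Lemma entails_neg G A : entails (A :: G) Bot -> entails G (Neg A).
Proof.
move=> GA; apply: entails_contra; apply: (@entails_mp A).
  exact: (@entails_weak _ G (Imp A Bot)).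
apply: entails_contra.
exact: entails_absurd (entails_id1 _ _ _) (entails_id _ _).
Qed.

Lemma entails_cut A G B : entails [:: A] B -> entails G A -> entails G B.
Proof. by move=> AB; apply: entails_mp; apply: entails_thm. Qed.

Lemma entails_box G A : entails G A -> entails (map Box G) (Box A).
Proof.
elim: G A => [|H G IHG] A; first exact: NQGL_nec.
move=> /IHG; apply: (@entails_mp _ (map Box G) (Imp (Box H) (Box A))).
exact/entails_thm/NQGL_ax/QK4_QK/QK_K.
Qed.

Lemma entails_boxn k G A :
  entails G A -> entails (map (boxn k) G) (boxn k A).
Proof.
move=> GA; elim: k => [|k IHk] /=; first by rewrite map_id.
by have := entails_box IHk; rewrite -map_comp.
Qed.

Lemma entails_box4 G A : entails G (Box A) -> entails G (Box (Box A)).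
Proof. by apply: entails_mp; apply/entails_thm/NQGL_ax/QK4_4. Qed.

Lemma entails_box_boxn k G A : entails G (Box A) -> entails G (boxn k.+1 A).
Proof.
elim: k G A => [//|k IHk] G A /entails_box4.
exact: entails_cut (entails_box (IHk [:: Box A] A (entails_id _ _))).
Qed.

Lemma entails_imp_boxn k G A B :
  entails G (Box (Imp A B)) -> entails G (Imp (boxn k.+1 A) (boxn k.+1 B)).
Proof.
move=> /(entails_box_boxn k); apply: entails_cut.
apply: (@entails_boxn k.+1 [:: A; Imp A B]).
exact: entails_mp (entails_id1 _ _ _) (entails_id _ _).
Qed.

Lemma entails_boxn_bot m n G :
  m <= n -> entails G (boxn m Bot) -> entails G (boxn n Bot).
Proof.
move=> le_mn; rewrite -(subnKC le_mn) /boxn iterD.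
apply: entails_cut; apply: (@entails_boxn m [:: Bot]).
exact/NQGL_fol/ax_bot.
Qed.

Lemma entails_gen u G A :
  all (fun H => ~~ free u H) G -> entails G A -> entails G (All u A).
Proof.
elim: G A => [|H G IHG] A /=; first by move=> _; apply: NQGL_gen.
case/andP=> uH uG /(IHG _ uG); apply: (@entails_mp _ G (Imp H (All u A))).
exact/entails_thm/NQGL_fol/ax_dist.
Qed.

Lemma entails_inst v u G A :
  free_for v u A -> entails G (All u A) -> entails G (subst u v A).
Proof. by move=> fA; apply: entails_mp; apply/entails_thm/NQGL_fol/ax_inst. Qed.

Definition Iff (A B : form) := Neg (Imp (Imp A B) (Neg (Imp B A))).

Lemma entails_iff G A B :
  entails G (Imp A B) -> entails G (Imp B A) -> entails G (Iff A B).
Proof.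
move=> GAB GBA; apply: entails_neg.
apply: entails_absurd (entails_weak _ GBA).
exact: entails_mp (entails_id _ _) (entails_weak _ GAB).
Qed.

Lemma entails_iffl G A B : entails G (Iff A B) -> entails G (Imp A B).
Proof.
move=> GAB; apply: entails_contra; apply: entails_absurd (entails_weak _ GAB) _.
exact: (@entails_absurd (Imp A B :: _) _ _ (entails_id1 _ _ _) (entails_id _ _)).
Qed.

Lemma entails_iffr G A B : entails G (Iff A B) -> entails G (Imp B A).
Proof.
move=> GAB; apply: entails_contra; apply: entails_absurd (entails_weak _ GAB) _.
exact: (@entails_weak _ (_ :: G) (Neg (Imp B A)) (entails_id _ _)).
Qed.

Lemma entails_box_iffl G A B :
  entails G (Box (Iff A B)) -> entails G (Box (Imp A B)).
Proof.
exact: entails_cut (entails_box (entails_iffl (entails_id (Iff A B) [::]))).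
Qed.

Lemma entails_box_iffr G A B :
  entails G (Box (Iff A B)) -> entails G (Box (Imp B A)).
Proof.
exact: entails_cut (entails_box (entails_iffr (entails_id (Iff A B) [::]))).
Qed.

(** * The sentences *)

Definition name (b : nat) (x : var) : form := @Atom 1 b [tuple x].

Definition index (b i : nat) (x : var) : form :=
  Box (Iff (name b x) (boxn (i.*2 + b) Bot)).

Definition next (b : nat) (x y : var) : form :=
  Box (Iff (name b x) (Box (Box (name b y)))).

(** The implication encodes a disjunction, with the existential over [y] expressed through [All] and
    [Neg]. *)
Definition naming (b : nat) : form :=
  All 0 (Imp (All 1 (Neg (next b 0 1))) (index b 0 0)).

(* The negation says that [naming b] holds and some [x] satisfies
   [Box (Box (name b x))] but not [Box (name b x)]. *)
Definition parity (b : nat) : form :=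
  Imp (naming b) (All 0 (Imp (Box (Box (name b 0))) (Box (name b 0)))).

(** A finite disjunction over the indices [i < d], with [Bot] as the empty one. *)
Fixpoint index_lt (b d : nat) (x : var) : form :=
  if d is d'.+1 then Imp (Neg (index b d' x)) (index_lt b d' x) else Bot.

(** * Substitution and free variables in the sentences *)

Lemma subst_name b u v x :
  subst u v (name b x) = name b (if x == u then v else x).
Proof. by congr Atom; apply: val_inj. Qed.

Lemma subst_notfree u v A : ~~ free u A -> subst u v A = A.
Proof.
elim: A => [||n k us|B IHB|B IHB C IHC|x B IHB|B IHB] //=.
- move=> nu; congr Atom; apply: val_inj; rewrite /= map_id_in // => w us_w.
  by case: eqP nu => // <-; rewrite us_w.
- by move/IHB->.
- by rewrite negb_or => /andP[/IHB-> /IHC->].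
- by case: eqVneq => //= _ /IHB->.
- by move/IHB->.
Qed.

Lemma subst_boxn u v k A : subst u v (boxn k A) = boxn k (subst u v A).
Proof. by elim: k => //= k ->. Qed.

Lemma free_boxn u k A : free u (boxn k A) = free u A.
Proof. by elim: k. Qed.

Lemma free_for_boxn v u k A : free_for v u (boxn k A) = free_for v u A.
Proof. by elim: k. Qed.

Lemma subst_index b i u v x :
  subst u v (index b i x) = index b i (if x == u then v else x).
Proof.
rewrite -[LHS]/(Box (Iff (subst u v (name b x)) (subst u v (boxn _ Bot)))).
by rewrite subst_name subst_boxn.
Qed.

Lemma subst_index_lt b d u v x :
  subst u v (index_lt b d x) = index_lt b d (if x == u then v else x).
Proof.
elim: d => // d IHd.
rewrite -[LHS]/(Imp (Neg (subst u v (index b d x))) (subst u v (index_lt b d x))).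
by rewrite subst_index IHd.
Qed.

Lemma free_for_index_lt b d v u x : free_for v u (index_lt b d x).
Proof. by elim: d => //= d ->; rewrite free_for_boxn. Qed.

Lemma free_index_lt b d u x : u != x -> free u (index_lt b d x) = false.
Proof.
move=> neq_ux; elim: d => //= d ->.
by rewrite free_boxn /= mem_seq1 (negPf neq_ux).
Qed.

(** * Deriving the rank from the sentences *)

Lemma entails_index_lt b i d x G :
  i < d -> entails G (index b i x) -> entails G (index_lt b d x).
Proof.
move=> + Gi; elim: d => //= d IHd; rewrite ltnS leq_eqVlt.
case/predU1P=> [<-|/IHd]; last exact: (@entails_weak _ G).
exact: (@entails_absurd (_ :: G) _ _ (entails_id _ _) (entails_weak _ Gi)).
Qed.

Lemma entails_index_lt_bot b d x G :
  (forall i, i < d -> entails (index b i x :: G) Bot) ->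
  entails G (index_lt b d x) -> entails G Bot.
Proof.
elim: d => [//|d IHd] Gbot Gd; apply: IHd => [i /ltnW|]; first exact: Gbot.
exact: entails_mp Gd (entails_neg (Gbot d (ltnSn d))).
Qed.

(** Axiom 4 makes the index of [y] available inside the box. There it turns [Box (Box (name b y))]
    into two more boxes on a power of [Bot], so the exponent grows by two. *)
Lemma entails_next_index b i x y G :
  entails G (next b x y) -> entails G (index b i y) ->
  entails G (index b i.+1 x).
Proof.
move=> Gnext Gy; apply: (entails_mp _ (entails_box4 Gy)).
apply: entails_cut Gnext; rewrite /index /next doubleS !addSn.
set bot := boxn _ _; set P := name b x; set Q := name b y.
set H := [:: Box (Iff Q bot); Iff P (Box (Box Q))].
suff HP : entails H (Iff P (Box (Box bot))) by apply: entails_box HP.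
have HQ : entails H (Box (Iff Q bot)) by apply: entails_id.
have HPQ : entails H (Iff P (Box (Box Q))) by apply: entails_id1.
apply: entails_iff.
  apply: (@entails_mp (Box (Box Q)) (P :: H)).
    exact/entails_weak/(entails_imp_boxn 1)/entails_box_iffl.
  by apply: (entails_mp _ (entails_id P H)); apply/entails_weak/entails_iffl.
apply: (@entails_mp (Box (Box Q)) (Box (Box bot) :: H)).
  exact/entails_weak/entails_iffr.
apply: (entails_mp _ (entails_id (Box (Box bot)) H)).
exact/entails_weak/(entails_imp_boxn 1)/entails_box_iffr.
Qed.

(** Variable 0 is instantiated by itself; the result is the body itself only after the tuples in the
    atoms are identified. *)
Lemma entails_naming_elim b G :
  entails G (naming b) ->
  entails G (Imp (All 1 (Neg (next b 0 1))) (index b 0 0)).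
Proof.
set A := Imp _ _ => Gb.
have freeA : free_for 0 0 A by rewrite /= !free_for_boxn.
suff <- : subst 0 0 A = A by apply: entails_inst.
rewrite -[LHS]/(Imp (All 1 (Neg (Box (Iff (subst 0 0 (name b 0))
  (Box (Box (subst 0 0 (name b 1)))))))) (subst 0 0 (index b 0 0))).
by rewrite !subst_name subst_index.
Qed.

(* Where [boxn j (name b x)] fails, [boxn (j + 2) (name b y)] fails as well for
   every [y] with [next b x y], so after [d] passages from [x] to [y] one would
   contradict [boxn (j + 2 * d) Bot]. *)
Lemma entails_has_index b d j :
  entails [:: Neg (boxn j.+1 (name b 0)); boxn (j.+1 + d.*2) Bot; naming b]
    (index_lt b d 0).
Proof.
elim: d j => [|d IHd] j.
  apply: entails_absurd (entails_id _ _) _; rewrite addn0.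
  apply: entails_cut (entails_id1 _ _ _).
  apply: (@entails_boxn j.+1 [:: Bot]); exact/NQGL_fol/ax_bot.
set G := [:: _; _; _]; set D := index_lt b d.+1.
(* The induction hypothesis at [j + 2] speaks of variable 0. As a closed chain of implications it is
   a theorem, so it can be generalized and instantiated at variable 1. The bound on the rank is the
   same, as [j.+3 + d.*2] equals [j.+1 + d.+1.*2]. *)
have IHy : entails G (Imp (Neg (boxn j.+3 (name b 1))) (index_lt b d 1)).
  pose F y := Imp (naming b) (Imp (boxn (j.+3 + d.*2) Bot)
    (Imp (Neg (boxn j.+3 (name b y))) (index_lt b d y))).
  have subF : subst 0 1 (F 0) = F 1.
    rewrite -[LHS]/(Imp (naming b) (Imp (subst 0 1 (boxn (j.+3 + d.*2) Bot))
      (Imp (Neg (subst 0 1 (boxn j.+3 (name b 0))))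
        (subst 0 1 (index_lt b d 0))))).
    by rewrite !subst_boxn subst_name subst_index_lt.
  have freeF : free_for 1 0 (F 0).
    by rewrite /= !free_for_boxn free_for_index_lt.
  have F1 : NQGL (F 1).
    rewrite -subF.
    exact: (@entails_inst 1 0 [::]) freeF (NQGL_gen 0 (IHd j.+2)).
  apply: (@entails_mp (boxn (j.+3 + d.*2) Bot)).
    apply: (@entails_mp (naming b)); first exact: entails_thm.
    exact/entails_weak/entails_id1.
  rewrite /G doubleS !addnS; exact: entails_id1.
apply: entails_contra.
(* If [x] has no index up to [d], no [y] is next to it: such a [y] would have an index [i < d],
   giving [x] the index [i + 1]. Then [naming] gives [x] the index 0, a contradiction. *)
have Gnext : entails (Neg (D 0) :: G) (All 1 (Neg (next b 0 1))).
  apply: entails_gen.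
    by rewrite /= (free_index_lt _ _ (isT : 1 != 0)) !free_boxn.
  apply: entails_neg; set H := next _ _ _ :: _.
  have Hnext : entails H (next b 0 1) by apply: entails_id.
  apply: (@entails_index_lt_bot b d 1) => [i lt_id|].
    apply: (@entails_absurd _ (D 0)).
      exact/entails_weak/entails_id1.
    apply: (@entails_index_lt b i.+1) => //.
    apply: entails_next_index (entails_weak _ Hnext) (entails_id _ _).
  apply: (entails_mp (entails_weak _ (entails_weak _ IHy))).
  apply: entails_neg; apply: (@entails_absurd _ (boxn j.+1 (name b 0))).
    exact/entails_weak/entails_weak/entails_weak/entails_id.
  apply: (entails_mp _ (entails_id _ H)).
  have -> : boxn j.+3 (name b 1) = boxn j.+1 (Box (Box (name b 1))).
    by rewrite /boxn !iterSr.
  exact/entails_weak/entails_imp_boxn/entails_box_iffr.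
have G0 : entails (Neg (D 0) :: G) (index b 0 0).
  apply: (entails_mp _ Gnext); apply: entails_naming_elim.
  exact/entails_weak/entails_weak/entails_id1.
apply: entails_absurd (entails_id _ _) _.
exact: entails_index_lt (ltn0Sn d) G0.
Qed.

(** Elimination rule for a failing [parity b]: the premises of case [i] say that the rank is exactly
    [2i+b+1]. [C] must not contain variable 0 because [Neg C] is among the antecedents when that
    variable is generalized. *)
Lemma entails_parity_rank b d C : ~~ free 0 C ->
  (forall i, i < d -> entails
     [:: Neg (boxn (i.*2 + b).+1 Bot); boxn (i.*2 + b).+2 Bot] C) ->
  entails [:: Neg (parity b); boxn d.*2.+1 Bot] C.
Proof.
move=> C0 rankC; apply: entails_contra.
set H0 := _ :: _; set P := name b 0.
suff : entails [:: naming b & H0] (All 0 (Imp (Box (Box P)) (Box P))).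
  exact: (@entails_absurd H0 (parity b) _ (entails_id1 _ _ _)).
apply: entails_gen; first by rewrite /= C0 free_boxn.
suff : entails [:: Box (Box P), naming b & H0] (Box P) by [].
apply: entails_contra; set H := _ :: _.
apply: (@entails_index_lt_bot b d 0) => [i lt_id|].
  (* The index equates [name b 0] with [boxn m Bot] under boxes, so [Box (Box P)] and the negation
     of [Box P] become the two premises of [rankC]. *)
  set K := _ :: H; set m := i.*2 + b.
  have Ki : entails K (index b i 0) by apply: entails_id.
  have nC : entails K (Neg C) by do 4!apply: entails_weak; apply: entails_id.
  apply: entails_absurd nC _.
  have KC : entails K (Imp (boxn m.+2 Bot) (Imp (Neg (boxn m.+1 Bot)) C)).
    exact/entails_thm/rankC.
  apply: (entails_mp (entails_mp KC _)).
    have := entails_imp_boxn 1 (entails_box_iffl Ki).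
    by move/entails_mp; apply; do 2!apply: entails_weak; apply: entails_id.
  apply: entails_neg; apply: (@entails_absurd _ (Box P)).
    exact/entails_weak/entails_id1.
  have := entails_imp_boxn 0 (entails_box_iffr Ki).
  by move/(entails_weak (boxn m.+1 Bot))/entails_mp; apply; apply: entails_id.
have HH : entails H (Imp (naming b) (Imp (boxn (1 + d.*2) Bot)
    (Imp (Neg (Box P)) (index_lt b d 0)))).
  exact/entails_thm/(entails_has_index b d 0).
apply: (entails_mp (entails_mp (entails_mp HH _) _)).
- by do 2!apply: entails_weak; apply: entails_id.
- by do 5!apply: entails_weak; apply: entails_id.
- exact: entails_id.
Qed.

(** The infinitary rule allows the rank to be assumed bounded. If both parities failed, the rank
    would be [2i+1] and [2k+2] at once. *)
Lemma NQGL_parity : NQGL (Imp (Neg (parity 0)) (parity 1)).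
Proof.
apply: NQGL_inf => n.
suff: entails [:: Neg (parity 0); boxn n.+1 Bot] (parity 1) by [].
have leBn : n.+1 <= n.*2.+1 by rewrite ltnS -addnn leq_addr.
(* The antecedents still to be used are packed into the conclusion, here and in [C'], so that the
   elimination rule applies once per parity. *)
pose C := Imp (boxn n.*2.+1 Bot) (Imp (Neg (parity 1)) Bot).
have C0 : ~~ free 0 C by rewrite /= !free_boxn.
suff /(entails_parity_rank C0) P0 : forall i, i < n -> entails
    [:: Neg (boxn (i.*2 + 0).+1 Bot); boxn (i.*2 + 0).+2 Bot] C.
  apply: entails_contra; set H := _ :: _.
  have Hbox : entails H (boxn n.*2.+1 Bot).
    by apply: (entails_boxn_bot leBn); apply/entails_weak/entails_id1.
  have HP0 : entails H (Imp (boxn n.*2.+1 Bot) (Imp (Neg (parity 0)) C)).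
    exact/entails_thm/P0.
  have HC := entails_mp (entails_mp HP0 Hbox) (entails_id1 _ _ _).
  exact: entails_mp (entails_mp HC Hbox) (entails_id _ _).
move=> i _; rewrite addn0.
pose C' := Imp (boxn i.*2.+2 Bot) (Imp (Neg (boxn i.*2.+1 Bot)) Bot).
have C'0 : ~~ free 0 C' by rewrite /= !free_boxn.
suff /(entails_parity_rank C'0) P1 : forall k, k < n -> entails
    [:: Neg (boxn (k.*2 + 1).+1 Bot); boxn (k.*2 + 1).+2 Bot] C'.
  rewrite -[entails _ C]/(entails [:: Neg (parity 1); boxn n.*2.+1 Bot;
    Neg (boxn i.*2.+1 Bot); boxn i.*2.+2 Bot] Bot).
  set H := _ :: _.
  have HP1 : entails H (Imp (boxn n.*2.+1 Bot) (Imp (Neg (parity 1)) C')).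
    exact/entails_thm/P1.
  have HC' := entails_mp (entails_mp HP1 (entails_id1 _ _ _)) (entails_id _ _).
  apply: (entails_mp (entails_mp HC' _)).
    by do 3!apply: entails_weak; apply: entails_id.
  by apply/entails_weak/entails_id1.
move=> k _.
rewrite addn1 -[entails _ C']/(entails [:: Neg (boxn i.*2.+1 Bot);
  boxn i.*2.+2 Bot; Neg (boxn k.*2.+2 Bot); boxn k.*2.+3 Bot] Bot).
have [le_ik | lt_ki] := leqP i k.
  apply: (@entails_absurd _ (boxn k.*2.+2 Bot)).
    exact/entails_weak/entails_id1.
  by apply: entails_boxn_bot (entails_id1 _ _ _); rewrite !ltnS leq_double.
apply: entails_absurd (entails_id _ _) _.
apply: (@entails_boxn_bot k.*2.+3); first by rewrite ltnS -doubleS leq_double.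
by do 3!apply: entails_weak; apply: entails_id.
Qed.

(** * Forcing on the chain of natural numbers *)

Definition upd (T : Type) (e : var -> T) u d : var -> T :=
  fun x => if x == u then d else e x.

(** The constant finite domain and the finitely many worlds below [w] keep forcing boolean. *)
Fixpoint force (T : finType) (I : nat -> forall n, nat -> n.-tuple T -> bool)
    (A : form) (w : nat) (e : var -> T) : bool :=
  match A with
  | Top => true
  | Bot => false
  | Atom n k us => I w n k (map_tuple e us)
  | Neg B => ~~ force I B w e
  | Imp B C => force I B w e ==> force I C w e
  | All u B => [forall d, force I B w (upd e u d)]
  | Box B => all (fun v => force I B v e) (iota 0 w)
  end.

Section Soundness.

Variables (T : finType) (I : nat -> forall n, nat -> n.-tuple T -> bool).
Implicit Types (A B : form) (w v : nat) (e : var -> T).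

Lemma force_neg A w e : force I (Neg A) w e = ~~ force I A w e.
Proof. by []. Qed.

Lemma force_impP A B w e :
  reflect (force I A w e -> force I B w e) (force I (Imp A B) w e).
Proof. exact: implyP. Qed.

Lemma force_allP u A w e :
  reflect (forall d, force I A w (upd e u d)) (force I (All u A) w e).
Proof. exact: forallP. Qed.

Lemma force_boxP A w e :
  reflect (forall v, v < w -> force I A v e) (force I (Box A) w e).
Proof.
apply: (iffP allP) => fA v; first by move=> lt_vw; apply: fA; rewrite mem_iota.
by rewrite mem_iota => /fA.
Qed.

Lemma eq_force A w e e' :
  (forall x, free x A -> e x = e' x) -> force I A w e = force I A w e'.
Proof.
elim: A w e e' => [||n k us|B IHB|B IHB C IHC|u B IHB|B IHB] w e e' //= eqe.
- by congr (I w k _); apply/val_inj/eq_in_map.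
- by rewrite (IHB w e e').
- rewrite (IHB w e e') ?(IHC w e e') // => x fx; apply: eqe; rewrite fx //.
  by rewrite orbT.
- apply: eq_forallb => d; apply: IHB => x fx; rewrite /upd.
  by case: eqP => // /eqP neq_xu; apply: eqe; rewrite neq_xu.
- by apply: eq_all => v; apply: IHB.
Qed.

Lemma force_subst A u v w e : free_for v u A ->
  force I (subst u v A) w e = force I A w (upd e u (e v)).
Proof.
elim: A w e => [||n k us|B IHB|B IHB C IHC|x B IHB|B IHB] w e //=.
- move=> _; congr (I w k _); apply: val_inj; rewrite /= -map_comp.
  by apply: eq_map => x /=; rewrite /upd; case: eqP.
- by move=> /IHB ->.
- by case/andP=> /IHB -> /IHC ->.
- have [-> _ | neq_xu] := eqVneq x u.
    apply: eq_forallb => d; apply: eq_force => y _; rewrite /upd.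
    by case: eqP.
  rewrite /= => ffB.
  apply: eq_forallb => d; have [fuB|nfuB] := boolP (free u B).
    move: ffB; rewrite fuB /= => /andP[neq_xv ffB].
    rewrite IHB //; apply: eq_force => y _; rewrite /upd.
    rewrite [v == x]eq_sym (negPf neq_xv).
    by case: (eqVneq y u) => // ->; rewrite eq_sym (negPf neq_xu).
  rewrite subst_notfree //; apply: eq_force => y fyB; rewrite /upd.
  by case: (eqVneq y x) => // _; case: eqP fyB nfuB => // -> ->.
- by move=> ffB; apply: eq_all => y; apply: IHB.
Qed.

Lemma force_boxn_bot n w e : force I (boxn n Bot) w e = (w < n).
Proof.
elim: n w => [//|n IHn] w; apply/force_boxP/idP => [fn|le_wn v lt_vw].
  by case: w fn => // w /(_ w (ltnSn w)); rewrite IHn.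
by rewrite -/(boxn n Bot) IHn (leq_trans lt_vw).
Qed.

Lemma sound A w e : NQGL A -> force I A w e.
Proof.
move=> thmA; elim: thmA w e => {A}.
- move=> _ [_ [_ [|A|A B|A B C|A B|u v A ffA|u A B nuA]|A B]|A] w e //.
  + by rewrite /=; case: (force I A w e) (force I B w e) => [] [].
  + by rewrite /=; case: (force I A w e) (force I B w e) (force I C w e) =>
      [] [] [].
  + by rewrite /=; case: (force I A w e) (force I B w e) => [] [].
  + by apply/force_impP=> /force_allP fA; rewrite force_subst.
  + apply/force_impP=> /force_allP fAB; apply/force_impP=> fA.
    apply/force_allP=> d.
    move/force_impP: (fAB d); apply; rewrite (@eq_force A w _ e) // => x fx.
    by rewrite /upd; case: eqP fx nuA => // -> ->.
  + apply/force_impP=> /force_boxP fAB; apply/force_impP=> /force_boxP fA.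
    apply/force_boxP=> v lt_vw; move/force_impP: (fAB v lt_vw); apply.
    exact: fA.
  + apply/force_impP=> /force_boxP fA; apply/force_boxP=> v lt_vw.
    by apply/force_boxP=> x /ltn_trans/(_ lt_vw)/fA.
- by move=> A B _ fAB _ fA w e; move/force_impP: (fAB w e); apply.
- by move=> u A _ fA w e; apply/force_allP=> d; apply: fA.
- by move=> A _ fA w e; apply/force_boxP=> v _; apply: fA.
(* Every world has finite rank: [w] forces [boxn w.+1 Bot], so the premise numbered [w] suffices. *)
- move=> A _ fA w e; move/force_impP: (fA w w e); apply.
  by rewrite force_boxn_bot.
Qed.

End Soundness.

(** The function [f] is chosen before the model, so one threshold serves all domains and
    interpretations. *)
Lemma force_no_atoms A : (forall n k, ~~ occurs n k A) ->
  exists f : nat -> bool,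
    (exists N, forall w, N <= w -> f w = f N) /\
    forall T I w e, @force T I A w e = f w.
Proof.
elim: A => [||n k us|B IHB|B IHB C IHC|u B IHB|B IHB] no.
- by exists (fun=> true); split=> //; exists 0.
- by exists (fun=> false); split=> //; exists 0.
- by have := no n k; rewrite /= !eqxx.
- have [f [[N fN] fB]] := IHB no.
  exists (fun w => ~~ f w); split=> [|T I w e]; last by rewrite /= fB.
  by exists N => w /fN ->.
- have [|f [[N fN] fB]] := IHB.
    by move=> n k; have := no n k; rewrite /= negb_or => /andP[].
  have [|g [[M gM] gC]] := IHC.
    by move=> n k; have := no n k; rewrite /= negb_or => /andP[].
  exists (fun w => f w ==> g w); split=> [|T I w e]; last by rewrite /= fB gC.
  exists (maxn N M) => w; rewrite geq_max => /andP[leN leM].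
  by rewrite (fN w leN) (gM w leM) (fN _ (leq_maxl N M)) (gM _ (leq_maxr N M)).
- have [f [fN fB]] := IHB no; exists f; split=> // T I w e /=.
  (* The assignment witnesses that the domain is nonempty. *)
  apply/forallP/idP => [/(_ (e 0))|fw d]; by rewrite fB.
- have [f [[N fN] fB]] := IHB no.
  exists (fun w => all f (iota 0 w)); split=> [|T I w e]; last first.
    by apply: eq_all => v; apply: fB.
  (* From [N.+1] on, the worlds below include [N] itself, and any further ones repeat the value
     [f N]. *)
  exists N.+1 => w lt_Nw; rewrite -(subnKC lt_Nw) iotaD all_cat.
  case: (boolP (all f (iota 0 N.+1))) => // /allP fle; apply/allP=> v.
  rewrite mem_iota => /andP[lt_Nv _]; rewrite fN ?(ltnW lt_Nv) //.
  by apply: fle; rewrite mem_iota /= add0n.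
Qed.

(** * Vocabularies and countermodels of the two sentences *)

Lemma free_parity b x : ~~ free x (parity b).
Proof.
by rewrite /parity /= !free_boxn !mem_seq1; case: x => [|[|x]].
Qed.

Lemma occurs_boxn n k m A : occurs n k (boxn m A) = occurs n k A.
Proof. by elim: m. Qed.

Lemma occurs_parity b n k : occurs n k (parity b) -> k = b.
Proof.
rewrite /= !occurs_boxn /= !orbF.
by case: (b =P k) => [->|_] //; rewrite !andbF.
Qed.

(* At world [v] the name of [x] is true iff [v < 2 * x + b]. *)
Definition rank_model N (v n k : nat) (us : n.-tuple 'I_N.+1) : bool :=
  all (fun x : 'I_N.+1 => v < x.*2 + k) us.

Lemma force_name N b x v e :
  force (@rank_model N) (name b x) v e = (v < (e x).*2 + b).
Proof. by rewrite /= /rank_model /= andbT. Qed.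

Lemma force_iff T I A B w e :
  @force T I (Iff A B) w e = (force I A w e == force I B w e).
Proof. by rewrite /=; case: (force I A w e) (force I B w e) => [] []. Qed.

Lemma force_box2_name N b x v e :
  force (@rank_model N) (Box (Box (name b x))) v e = (v < ((e x).*2 + b).+2).
Proof.
apply/force_boxP/idP => [fv|le_vx u lt_uv].
  rewrite ltnS; case: v fv => // v fv; rewrite ltnS.
  case: v fv => // v /(_ v.+1 (ltnSn _))/force_boxP/(_ v (ltnSn _)).
  by rewrite force_name.
apply/force_boxP=> t lt_tu; rewrite force_name.
exact: leq_ltn_trans (leq_ltn_trans lt_tu lt_uv) le_vx.
Qed.

Lemma force_naming N b w e : force (@rank_model N) (naming b) w e.
Proof.
apply/force_allP=> x; apply/force_impP=> /force_allP no_next.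
apply/force_boxP=> v lt_vw; rewrite force_iff force_name force_boxn_bot /=.
(* Individual 0 has index 0; a positive [x] has its predecessor next to it. *)
case: (posnP x) => [->//|x_gt0].
have lt_xN : x.-1 < N.+1 by rewrite (leq_ltn_trans (leq_pred x)).
pose y := Ordinal lt_xN.
suff fnext : force (@rank_model N) (next b 0 1) w (upd (upd e 0 x) 1 y).
  by have /negP := no_next y.
apply/force_boxP=> u lt_uw; rewrite force_iff force_name.
rewrite force_box2_name /= -!addSn -doubleS prednK //.
Qed.

(** The largest individual refutes [parity b]: its name holds exactly below [2N+b], hence its double
    box holds at [2N+b+1] while its single box fails there. *)
Lemma force_parity N b e :
  force (@rank_model N) (Neg (parity b)) (N.*2 + b).+1 e.
Proof.
rewrite force_neg; apply/negP=> /force_impP/(_ (force_naming _ _ _)).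
move/force_allP/(_ ord_max).
move/force_impP; rewrite force_box2_name ltnSn => /(_ isT)/force_boxP.
by move/(_ (N.*2 + b) (ltnSn _)); rewrite force_name ltnn.
Qed.

Theorem theorem5p2 : ~ craig_interpolation NQGL.
Proof.
move=> craig.
have [C [_ vocC NQGL_AC NQGL_CB]] :=
  craig (Neg (parity 0)) (parity 1) (free_parity 0) (free_parity 1) NQGL_parity.
have noC n k : ~~ occurs n k C.
  apply/negP=> /vocC/andP[/occurs_parity k0 /occurs_parity].
  by rewrite k0.
have [f [[N fN] fC]] := force_no_atoms noC.
(* The model is sized by the threshold [N] of the interpolant, so that both [2N+1], where [C] must
   hold, and [2N+2], where it must fail, lie beyond it. *)
pose I := @rank_model N; pose e (x : var) : 'I_N.+1 := ord_max.
have leN k : N <= (N.*2 + k).+1.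
  by rewrite -addnn -addnA -addnS leq_addr.
have f0 : f (N.*2 + 0).+1.
  rewrite -(fC _ I _ e).
  have /force_impP := sound I (N.*2 + 0).+1 e NQGL_AC; apply.
  exact: force_parity.
have f1 : ~~ f (N.*2 + 1).+1.
  rewrite -(fC _ I _ e).
  have /force_impP/contraNN := sound I (N.*2 + 1).+1 e NQGL_CB; apply.
  exact: force_parity.
by move: f1; rewrite fN // -(fN _ (leN 0)) f0.
Qed.
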